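(* Let $\mathcal{O}\subset\mathbb{R}^n$ be a closed obstacle set and $\mathcal{F} = \mathcal{W}\setminus\mathcal{O}$ the (open) free space of a workspace $\mathcal{W}\subseteq\mathbb{R}^n$. Consider the robot-governor system $\dot{\tilde{\mathbf{s}}} = \bar A\tilde{\mathbf{s}}$, $\dot{\mathbf{g}} = \mathbf{u}_{\mathbf{g}}$ with $\bar A$ Hurwitz, and an initial state $(\mathbf{x}_0-\mathbf{g}_0,\mathbf{y}_0,\mathbf{g}_0)$ at time $t_0$ with $\mathbf{x}_0,\mathbf{g}_0\in\mathcal{F}$. Suppose $\mathbf{u}_{\mathbf{g}}(t)\equiv 0$ so that $\mathbf{g}(t)\equiv\mathbf{g}_0$. Let $Q := Q[\mathbf{g}_0-\mathbf{x}_0]$, $C := Q^{1/2}P$, $\tilde{\mathbf{s}}_0 := (\mathbf{x}_0-\mathbf{g}_0,\mathbf{y}_0)$, and let $\delta(t_0)$ be the optimal value of the semidefinite program: minimize $\delta$ over $U\in\mathbb{S}^{n_s}$, $\delta\in\mathbb{R}$, subject to $\bar A^TU+U\bar A\preceq 0$, $\tilde{\mathbf{s}}_0^TU\tilde{\mathbf{s}}_0\le 1$, $\begin{bmatrix}U & C^T\\ C&\delta I\end{bmatrix}\succeq 0$, $U\succ 0$ (so that $\delta(t_0)\ge \|\mathbf{x}(t)-\mathbf{g}_0\|_Q^2$ for all $t\ge t_0$). Suppose the safety condition $\delta(t_0) \le d_Q^2(\mathbf{g}_0,\mathcal{O})$ holds. Then the robot-governor system is globally exponentially stable with respect to the equilibrium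 $(\mathbf{x},\mathbf{y},\mathbf{g})=(\mathbf{g}_0,\mathbf{0},\mathbf{g}_0)$, and the robot trajectory is collision free: $\mathbf{x}(t)\in\mathcal{F}$ for all $t\ge t_0$.
   Context: Robot state $\mathbf{s}=(\mathbf{x},\mathbf{y})$, $\mathbf{x}\in\mathbb{R}^n$ position, $\mathbf{y}\in\mathbb{R}^{n_s-n}$; $P=[I,\,0]$ projects $\mathbf{s}$ to $\mathbf{x}$. Robot-governor state $\hat{\mathbf{s}}=(\tilde{\mathbf{s}},\mathbf{g})$ with $\tilde{\mathbf{s}}=(\mathbf{x}-\mathbf{g},\mathbf{y})$. The directional matrix for fixed $c_2>c_1>0$ is $Q[\mathbf{v}] = c_2 I + (c_1-c_2)\frac{\mathbf{v}\mathbf{v}^T}{\|\mathbf{v}\|^2}$ if $\mathbf{v}\neq0$, $Q[\mathbf{0}]=c_1I$. For symmetric positive definite $Q$: $\|\mathbf{x}\|_Q=\sqrt{\mathbf{x}^TQ\mathbf{x}}$, $d_Q(\mathbf{x},\mathcal{A}) := \inf_{\mathbf{a}\in\mathcal{A}}\|\mathbf{x}-\mathbf{a}\|_Q$, $Q^{1/2}$ the symmetric positive definite square root.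
   Formalization: The exterior of the workspace W is assumed to be part of the obstacle set O (so F is the complement of O); for an arbitrary W the trajectory could leave W far from O even though the safety condition holds. *)

(* Defs.v *)
From Stdlib Require Import Reals.
From mathcomp Require Import all_boot.
Set Implicit Arguments. Unset Strict Implicit. Unset Printing Implicit Defensive.
Local Open Scope R_scope.

Definition vec (k : nat) := 'I_k -> R.
Definition mat (p q : nat) := 'I_p -> 'I_q -> R.

Definition rsum (k : nat) (f : 'I_k -> R) : R := \big[Rplus/0]_(i < k) f i.

Definition kron (k : nat) (i j : 'I_k) : R := if i == j then 1 else 0.

Definition vsub k (u v : vec k) : vec k := fun i => u i - v i.
Definition dot k (u v : vec k) : R := rsum (fun i => u i * v i).
Definition normE k (v : vec k) : R := sqrt (dot v v).

Definition mv p q (A : mat p q) (v : vec q) : vec p := fun i => rsum (fun j => A i j * v j).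
Definition mm p q r (A : mat p q) (B : mat q r) : mat p r :=
  fun i j => rsum (fun k => A i k * B k j).
Definition tr p q (A : mat p q) : mat q p := fun i j => A j i.
Definition madd p q (A B : mat p q) : mat p q := fun i j => A i j + B i j.

Definition quad k (M : mat k k) (v : vec k) : R := dot v (mv M v).

Definition symmetric k (M : mat k k) : Prop := forall i j, M i j = M j i.
Definition psd k (M : mat k k) : Prop := symmetric M /\ forall v, 0 <= quad M v.
Definition nsd k (M : mat k k) : Prop := symmetric M /\ forall v, quad M v <= 0.
Definition pd k (M : mat k k) : Prop :=
  symmetric M /\ forall v, (exists i, v i <> 0) -> 0 < quad M v.

Definition normQ k (Q : mat k k) (v : vec k) : R := sqrt (quad Q v).

Definition Qdir k (c1 c2 : R) (v : vec k) : mat k k :=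
  if Req_EM_T (normE v) 0 then (fun i j => c1 * kron i j)
  else (fun i j => c2 * kron i j + (c1 - c2) * (v i * v j) / (normE v ^ 2)).

Definition is_sqrtm k (Q S : mat k k) : Prop := pd S /\ mm S S = Q.

(* Hurwitz: every (complex) eigenvalue a + i b of A has negative real part;
   A (p + i q) = (a + i b)(p + i q) with p + i q <> 0, written over the reals. *)
Definition hurwitz k (A : mat k k) : Prop :=
  forall (a b : R) (p q : vec k),
    (exists i, p i <> 0 \/ q i <> 0) ->
    (forall i, mv A p i = a * p i - b * q i) ->
    (forall i, mv A q i = b * p i + a * q i) ->
    a < 0.

Definition Pproj n m : mat n (n + m) := fun i j => if val i == val j then 1 else 0.
Arguments Pproj : clear implicits.

Definition is_glb (E : R -> Prop) (b : R) : Prop :=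
  (forall x, E x -> b <= x) /\ (forall c, (forall x, E x -> c <= x) -> c <= b).

Definition closed_vset n (O : vec n -> Prop) : Prop :=
  forall x, (forall eps, 0 < eps -> exists a, O a /\ normE (vsub x a) < eps) -> O x.
Definition open_vset n (F : vec n -> Prop) : Prop :=
  forall x, F x -> exists eps, 0 < eps /\ forall z, normE (vsub z x) < eps -> F z.

Definition is_dQ n (Q : mat n n) (x : vec n) (A : vec n -> Prop) (d : R) : Prop :=
  is_glb (fun r => exists a, A a /\ r = normQ Q (vsub x a)) d.

Definition stack n m (u : vec n) (w : vec m) : vec (n + m) :=
  fun i => match split i with inl j => u j | inr k => w k end.

Definition sdp_feasible ns n (Abar : mat ns ns) (s0 : vec ns) (C : mat n ns)
    (U : mat ns ns) (delta : R) : Prop :=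
  nsd (madd (mm (tr Abar) U) (mm U Abar)) /\
  quad U s0 <= 1 /\
  psd (fun i j : 'I_(ns + n) =>
         match split i, split j with
         | inl i1, inl j1 => U i1 j1
         | inl i1, inr j2 => tr C i1 j2
         | inr i2, inl j1 => C i2 j1
         | inr i2, inr j2 => delta * kron i2 j2
         end) /\
  pd U.

Definition solves k (Abar : mat k k) (s : R -> vec k) : Prop :=
  forall (i : 'I_k) (t : R), derivable_pt_lim (fun tau => s tau i) t (mv Abar (s t) i).

Definition xpos n m (s : R -> vec (n + m)) (g : vec n) (t : R) : vec n :=
  fun i => mv (Pproj n m) (s t) i + g i.
Definition ypos n m (s : R -> vec (n + m)) (t : R) : vec m :=
  fun j => s t (@rshift n m j).

(* deviation of the full robot-governor state (x, y, g) from (g0, 0, g0),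
   for a governor held constant g(t) = g0 *)
Definition rg_dev n m (s : R -> vec (n + m)) (g0 : vec n) (t : R) : vec (n + m + n) :=
  fun k => match split k with
           | inl k1 => match split k1 with
                       | inl i => xpos s g0 t i - g0 i
                       | inr j => ypos s t j - 0
                       end
           | inr i => g0 i - g0 i
           end.

Definition rg_GES n m (Abar : mat (n + m) (n + m)) (g0 : vec n) : Prop :=
  exists M lam, 0 < lam /\
    forall (s : R -> vec (n + m)) (t1 : R), solves Abar s ->
      forall t, t1 <= t ->
        normE (rg_dev s g0 t) <= M * exp (- lam * (t - t1)) * normE (rg_dev s g0 t1).

(* Main.v *)
Require Import Defs.
From Stdlib Require Import Reals Classical FunctionalExtensionality.
From mathcomp Require Import all_boot all_order all_algebra.
From mathcomp Require Import complex Rstruct ring lra.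

(** Stability: the characteristic polynomial splits over the complex numbers with
    roots in the left half-plane, and Cayley-Hamilton turns the factorization into
    a cascade of damped scalar systems, for which a weighted sum of squared norms
    is a Lyapunov function.

    Safety: by the Schur complement, |C s(t)|^2 <= delta V(t) with
    V(t) = s(t)^T U s(t) nonincreasing and V(t0) <= 1, hence |C s(t)|^2 <= delta0.
    As the safety condition is not strict and the obstacle is closed, this bound
    still allows the trajectory to touch the obstacle when delta0 equals the squared
    distance, and the optimum need not be attained; so one needs V(t1) <= 1 - rho
    with rho > 0 independent of U.  The samples s_i s_j (t0 + k h) satisfy a common
    linear recurrence, whose polynomial q can be chosen with q(1) <> 0 because the
    products tend to 0.  Hence sum_k q_k V(t0 + k h) = 0 for all U at once, which
    keeps V(t1) away from 1. *)

Section Calculus.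
Import Order.TTheory GRing.Theory Num.Theory.
Set Implicit Arguments. Unset Strict Implicit.
Local Open Scope ring_scope.
(* Reals binds R_scope to R, which would parse arguments of type R with the
   Stdlib operations. *)
Bind Scope ring_scope with R.
Local Arguments derivable_pt_lim (_ _ _)%_ring_scope.
Local Arguments exp _%_ring_scope.

Lemma derivable_pt_lim_eq (f : R -> R) (x l l' : R) :
  l = l' -> derivable_pt_lim f x l' -> derivable_pt_lim f x l.
Proof. by move=> ->. Qed.

Lemma derivable_pt_limD (f g : R -> R) (x l l' : R) :
  derivable_pt_lim f x l -> derivable_pt_lim g x l' ->
  derivable_pt_lim (fun y => f y + g y) x (l + l').
Proof. exact: derivable_pt_lim_plus. Qed.

Lemma derivable_pt_limM (f g : R -> R) (x l l' : R) :
  derivable_pt_lim f x l -> derivable_pt_lim g x l' ->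
  derivable_pt_lim (fun y => f y * g y) x (l * g x + f x * l').
Proof. exact: derivable_pt_lim_mult. Qed.

Lemma derivable_pt_limMl (c : R) (f : R -> R) (x l : R) :
  derivable_pt_lim f x l -> derivable_pt_lim (fun y => c * f y) x (c * l).
Proof. exact: derivable_pt_lim_scal. Qed.

Lemma derivable_pt_lim_sum (I : finType) (f : I -> R -> R) (x : R) (l : I -> R) :
  (forall i, derivable_pt_lim (f i) x (l i)) ->
  derivable_pt_lim (fun y => \sum_i f i y) x (\sum_i l i).
Proof.
move=> H; elim: (index_enum I) => [|i r IH].
  rewrite big_nil; apply: (derivable_pt_lim_ext (fun=> 0)) => [y|].
    by rewrite big_nil.
  exact: derivable_pt_lim_const.
rewrite big_cons; apply: (derivable_pt_lim_ext (fun y => f i y + \sum_(j <- r) f j y)).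
  by move=> y; rewrite big_cons.
exact: derivable_pt_limD.
Qed.

Lemma derivable_pt_lim_shift (f : R -> R) (c x l : R) :
  derivable_pt_lim f (x + c) l -> derivable_pt_lim (fun y => f (y + c)) x l.
Proof.
move=> H; apply: (@derivable_pt_lim_eq _ _ _ (l * (1 + 0))); first by rewrite addr0 mulr1.
apply: (derivable_pt_lim_comp (fun y => y + c) f) => //.
apply: derivable_pt_limD; [exact: derivable_pt_lim_id | exact: derivable_pt_lim_const].
Qed.

Lemma deriv_nonpos_le (f f' : R -> R) (a b : R) : a <= b ->
  (forall c, derivable_pt_lim f c (f' c)) ->
  (forall c, a <= c -> f' c <= 0) -> f b <= f a.
Proof.
rewrite le_eqVlt => /orP [/eqP -> //|ab] df nf.
have /RltP ab' := ab.
have [c [e [/RltP ac _]]] := MVT_cor2 f f' a b ab' (fun c _ => df c).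
rewrite -subr_le0; change (Rminus (f b) (f a) <= 0); rewrite e.
by rewrite mulr_le0_ge0 ?nf ?(ltW ac) // subr_ge0 ltW.
Qed.

Lemma gronwall (u u' : R -> R) (K a b : R) : a <= b ->
  (forall c, derivable_pt_lim u c (u' c)) ->
  (forall c, u' c <= K * u c) -> u b <= exp (K * (b - a)) * u a.
Proof.
move=> ab du le.
have dE c : derivable_pt_lim (fun y => exp (- K * (y + - a))) c (exp (- K * (c + - a)) * (- K * (1 + 0))).
  apply: (derivable_pt_lim_comp (fun y => - K * (y + - a)) exp); last exact: derivable_pt_lim_exp.
  apply: derivable_pt_limMl; apply: derivable_pt_limD; first exact: derivable_pt_lim_id.
  exact: derivable_pt_lim_const.
have epos x : 0 < exp x by apply/RltP; exact: exp_pos.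
have := deriv_nonpos_le ab (fun c => derivable_pt_limM (dE c) (du c)).
have neg c : a <= c -> exp (- K * (c + - a)) * (- K * (1 + 0)) * u c + exp (- K * (c + - a)) * u' c <= 0.
  by move=> _; have := le c; rewrite -(ler_pM2l (epos (- K * (c + - a)))); lra.
move=> /(_ neg); rewrite addrN mulr0 (exp_0 : exp 0 = 1) mul1r => H.
have -> : u b = exp (K * (b - a)) * (exp (- K * (b + - a)) * u b).
  rewrite mulrA expRD RplusE (_ : K * (b - a) + _ = 0); last by ring.
  by rewrite (exp_0 : exp 0 = 1) mul1r.
by rewrite ler_pM2l.
Qed.

End Calculus.

(** * Exponential stability of Hurwitz systems *)

Section Stability.
Import Order.TTheory GRing.Theory Num.Theory.
Set Implicit Arguments. Unset Strict Implicit.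
Local Open Scope ring_scope.
Local Arguments derivable_pt_lim (_ _ _)%_ring_scope.
Local Arguments exp _%_ring_scope.
Bind Scope ring_scope with R.

Local Notation Re := complex.Re.
Local Notation Im := complex.Im.
Local Notation C := (complex R).

Definition sqmod (z : C) : R := Re z ^+ 2 + Im z ^+ 2.

Lemma sqmod_ge0 z : 0 <= sqmod z.
Proof. by rewrite addr_ge0 ?sqr_ge0. Qed.

Lemma sqmodM x y : sqmod (x * y) = sqmod x * sqmod y.
Proof. by case: x y => [a b] [c d]; rewrite /sqmod /=; ring. Qed.

Lemma sqr_sum_le (I : finType) (x : I -> R) :
  (\sum_i x i) ^+ 2 <= #|I|%:R * \sum_i x i ^+ 2.
Proof.
rewrite expr2 mulr_suml.
have -> : #|I|%:R * \sum_i x i ^+ 2 =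
    \sum_i \sum_j (x i ^+ 2 / 2 + x j ^+ 2 / 2).
  under [RHS]eq_bigr => i _ do rewrite big_split /= sumr_const.
  rewrite big_split /= sumr_const sumrMnl -mulrnDl -big_split /= mulr_natl.
  by congr (_ *+ _); apply: eq_bigr => i _; field.
apply: ler_sum => i _; rewrite mulr_sumr; apply: ler_sum => j _.
have := sqr_ge0 (x i - x j); lra.
Qed.

Lemma sqmod_sum_le (I : finType) (x : I -> C) :
  sqmod (\sum_i x i) <= #|I|%:R * \sum_i sqmod (x i).
Proof.
by rewrite /sqmod !raddf_sum big_split mulrDr lerD ?sqr_sum_le.
Qed.

Definition sqnorm k (z : 'rV[C]_k) : R := \sum_i sqmod (z 0 i).

Lemma sqnorm_ge0 k (z : 'rV[C]_k) : 0 <= sqnorm z.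
Proof. by apply: sumr_ge0 => i _; exact: sqmod_ge0. Qed.

Lemma sqnorm_mulmx k (B : 'M[C]_k) :
  exists2 K, 0 <= K & forall z, sqnorm (z *m B) <= K * sqnorm z.
Proof.
exists (k%:R * \sum_i \sum_j sqmod (B j i)).
  by rewrite mulr_ge0 ?ler0n // !sumr_ge0 // => i _; rewrite sumr_ge0 // => j _; exact: sqmod_ge0.
move=> z; rewrite -mulrA mulr_suml mulr_sumr; apply: ler_sum => i _; rewrite mxE.
apply: le_trans (sqmod_sum_le _) _; rewrite card_ord ler_wpM2l ?ler0n // mulr_suml.
apply: ler_sum => j _; rewrite sqmodM mulrC ler_wpM2l ?sqmod_ge0 //.
by rewrite /sqnorm (bigD1 j) //= lerDl sumr_ge0 // => l _; exact: sqmod_ge0.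
Qed.

Definition cderiv (f : R -> C) (t : R) (l : C) : Prop :=
  derivable_pt_lim (fun x => Re (f x)) t (Re l) /\
  derivable_pt_lim (fun x => Im (f x)) t (Im l).

Lemma cderiv_mulr (f : R -> C) (t : R) (l c : C) :
  cderiv f t l -> cderiv (fun x => f x * c) t (l * c).
Proof.
move=> [dr di]; split.
- apply: (derivable_pt_lim_ext (fun x => Re c * Re (f x) + (- Im c) * Im (f x))).
    by move=> x; case: (f x) c => [p q] [r s] /=; ring.
  apply: (derivable_pt_lim_eq _ (derivable_pt_limD (derivable_pt_limMl _ dr) (derivable_pt_limMl _ di))).
  by case: l c {dr di} => [p q] [r s] /=; ring.
- apply: (derivable_pt_lim_ext (fun x => Im c * Re (f x) + Re c * Im (f x))).
    by move=> x; case: (f x) c => [p q] [r s] /=; ring.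
  apply: (derivable_pt_lim_eq _ (derivable_pt_limD (derivable_pt_limMl _ dr) (derivable_pt_limMl _ di))).
  by case: l c {dr di} => [p q] [r s] /=; ring.
Qed.

Lemma cderiv_sum (I : finType) (f : I -> R -> C) (t : R) (l : I -> C) :
  (forall i, cderiv (f i) t (l i)) ->
  cderiv (fun x => \sum_i f i x) t (\sum_i l i).
Proof.
move=> H; split.
- rewrite raddf_sum; apply: (derivable_pt_lim_ext (fun x => \sum_i Re (f i x))).
    by move=> x; rewrite raddf_sum.
  by apply: derivable_pt_lim_sum => i; case: (H i).
- rewrite raddf_sum; apply: (derivable_pt_lim_ext (fun x => \sum_i Im (f i x))).
    by move=> x; rewrite raddf_sum.
  by apply: derivable_pt_lim_sum => i; case: (H i).
Qed.

Definition row_solution k (B : 'M[C]_k) (z : R -> 'rV[C]_k) : Prop :=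
  forall t i, cderiv (fun x => z x 0 i) t ((z t *m B) 0 i).

Lemma row_solution_mulmx k (B D : 'M[C]_k) z : B *m D = D *m B ->
  row_solution B z -> row_solution B (fun t => z t *m D).
Proof.
move=> comm sol t i; rewrite -mulmxA -comm mulmxA.
rewrite mxE.
have := @cderiv_sum _ (fun j x => z x 0 j * D j i) t _
  (fun j => cderiv_mulr (D j i) (sol t j)).
by move=> [h1 h2]; split; [move: h1|move: h2]; apply: derivable_pt_lim_ext => x; rewrite mxE.
Qed.

Fixpoint killed k (B : 'M[C]_k) (ls : seq C) (z : 'rV[C]_k) : Prop :=
  if ls is l :: ls' then killed B ls' (z *m (B - l%:M)) else z = 0.

Lemma sqnorm_deriv k (B : 'M[C]_k) z t : row_solution B z ->
  derivable_pt_lim (fun x => sqnorm (z x)) t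
    (2 * \sum_i (Re (z t 0 i) * Re ((z t *m B) 0 i) + Im (z t 0 i) * Im ((z t *m B) 0 i))).
Proof.
move=> sol; rewrite mulr_sumr; apply: derivable_pt_lim_sum => i.
have [dr di] := sol t i.
apply: (derivable_pt_lim_eq _ (derivable_pt_limD (derivable_pt_limM dr dr) (derivable_pt_limM di di))).
ring.
Qed.

(* Young's inequality absorbs the coupling term into half of the decay
   [2 (Re l) |z|^2]. *)
Lemma sqnorm_deriv_le k (B : 'M[C]_k) (l : C) (z : 'rV[C]_k) : Re l < 0 ->
  2 * \sum_i (Re (z 0 i) * Re ((z *m B) 0 i) + Im (z 0 i) * Im ((z *m B) 0 i))
  <= Re l * sqnorm z - sqnorm (z *m (B - l%:M)) / Re l.
Proof.
move=> l0; rewrite mulr_sumr [X in _ <= X - _]mulr_sumr mulr_suml -sumrB.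
apply: ler_sum => i _.
have -> : (z *m B) 0 i = z 0 i * l + (z *m (B - l%:M)) 0 i.
  by rewrite mulmxBr mul_mx_scalar; move: (z *m B) => y; rewrite !mxE; ring.
have y (a p r : R) : a < 0 -> 2 * (p * r) <= - a * p ^+ 2 - r ^+ 2 / a.
  move=> a0; have an0 : a != 0 by rewrite lt_eqF.
  have : 0 <= (a * p + r) ^+ 2 / - a
    by apply: divr_ge0; [exact: sqr_ge0 | rewrite oppr_ge0 ltW].
  have -> : (a * p + r) ^+ 2 / - a = - a * p ^+ 2 - 2 * (p * r) - r ^+ 2 / a by field.
  lra.
move: (z 0 i) ((z *m (B - l%:M)) 0 i) => [p q] [r s]; rewrite /sqmod.
case: l l0 => a b /= a0; have := y a p r a0; have := y a q s a0; lra.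
Qed.

(* Along the chain z, z (B - l_1), z (B - l_1) (B - l_2), ... each term is damped
   and driven by the next one only, and the last term is 0. *)
Lemma lyapunov_exists k (B : 'M[C]_k) (ls : seq C) : all (fun l => Re l < 0) ls ->
  exists (W dW : 'rV[C]_k -> R) (M lam : R), [/\ 0 <= M, 0 < lam,
   forall z, killed B ls z ->
     [/\ sqnorm z <= W z, W z <= M * sqnorm z & dW z <= - lam * W z]
   & forall z, row_solution B z ->
       forall t, derivable_pt_lim (fun x => W (z x)) t (dW (z t))].
Proof.
elim: ls => [|l ls IH] /= => [_|/andP [l0 /IH]].
  exists (fun=> 0), (fun=> 0), 1, 1; split => // [z ->|z _ t]; last exact: derivable_pt_lim_const.
  have -> : sqnorm (0 : 'rV[C]_k) = 0.
    by rewrite /sqnorm big1 // => i _; rewrite mxE /sqmod expr0n addr0.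
  by rewrite !mulr0.
move=> [W [dW [M [lam [M0 lam0 bnd der]]]]].
have [K K0 hK] := sqnorm_mulmx (B - l%:M).
pose a := Re l; pose D : R := - 2 / (a * lam).
have an0 : a != 0 by rewrite lt_eqF.
have ln0 : lam != 0 by rewrite gt_eqF.
have D0 : 0 <= D.
  by rewrite /D mulNr -mulrN -invrN divr_ge0 // -mulNr mulr_ge0 // ?oppr_ge0 ltW.
exists (fun z : 'rV[C]_k => sqnorm z + D * W (z *m (B - l%:M))).
exists (fun z : 'rV[C]_k => 2 * \sum_i (Re (z 0 i) * Re ((z *m B) 0 i) + Im (z 0 i) * Im ((z *m B) 0 i))
   + D * dW (z *m (B - l%:M))).
exists (1 + D * (M * K)), (Num.min (- a) (lam / 2)); split.
- by apply: addr_ge0 => //; apply: mulr_ge0 => //; exact: mulr_ge0.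
- by rewrite lt_min oppr_gt0 l0 divr_gt0.
- move=> z /bnd [b1 b2 b3]; have W0 := le_trans (sqnorm_ge0 _) b1.
  split.
  + by rewrite lerDl mulr_ge0.
  + rewrite mulrDl mul1r lerD2l -mulrA ler_wpM2l //.
    by apply: le_trans b2 _; rewrite -mulrA ler_wpM2l.
  + have h := sqnorm_deriv_le B z l0.
    set mu := Num.min _ _.
    have mu1 : mu <= - a by rewrite ge_min lexx.
    have mu2 : mu <= lam / 2 by rewrite ge_min lexx orbT.
    have ai : 0 <= - a^-1 by rewrite oppr_ge0 invr_le0 ltW.
    have e1 : D * dW (z *m (B - l%:M)) <= 2 / a * W (z *m (B - l%:M)).
      apply: le_trans (ler_wpM2l D0 b3) _; rewrite le_eqVlt; apply/orP; left; apply/eqP.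
      by rewrite /D; field; rewrite an0 ln0.
    have e2 := ler_wpM2l ai b1.
    have e3 : mu * sqnorm z <= - a * sqnorm z by rewrite ler_wpM2r ?sqnorm_ge0.
    have e4 : mu * (D * W (z *m (B - l%:M))) <= - a^-1 * W (z *m (B - l%:M)).
      have -> : - a^-1 * W (z *m (B - l%:M)) = lam / 2 * (D * W (z *m (B - l%:M))).
        by rewrite /D; field; rewrite an0 ln0.
      by rewrite ler_wpM2r // mulr_ge0.
    rewrite -/a in h; lra.
- move=> z sol t; apply: derivable_pt_limD; first exact: sqnorm_deriv.
  apply: derivable_pt_limMl; apply: (der (fun t => z t *m (B - l%:M))).
  apply: row_solution_mulmx => //.
  by rewrite mulmxBr mulmxBl scalar_mxC.
Qed.

Lemma killed_char_poly k (B : 'M[C]_k.+1) : exists2 ls,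
  forall l, l \in ls -> eigenvalue B l & forall z, killed B ls z.
Proof.
have [ls e] := closed_field_poly_normal (char_poly B).
rewrite (monicP (char_poly_monic B)) scale1r in e.
exists ls => [l|z].
  by rewrite eigenvalue_root_char e root_prod_XsubC.
have : z *m horner_mx B (\prod_(l <- ls) ('X - l%:P)) = 0.
  by rewrite -e Cayley_Hamilton mulmx0.
elim: ls z {e} => [|l ls IH] z /=; first by rewrite big_nil rmorph1 mulmx1.
rewrite big_cons rmorphM rmorphB /= horner_mx_X horner_mx_C => h; apply: IH.
by rewrite -mulmxA.
Qed.

Definition vsq k (v : vec k) : R := \sum_i v i ^+ 2.

Lemma vsq_ge0 k (v : vec k) : 0 <= vsq v.
Proof. by apply: sumr_ge0 => i _; exact: sqr_ge0. Qed.

Lemma hurwitz_vsq_decay k (A : mat k k) : hurwitz A ->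
  exists M lam, [/\ 0 <= M, 0 < lam & forall s, solves A s -> forall t1 t, t1 <= t ->
    vsq (s t) <= exp (- lam * (t - t1)) * (M * vsq (s t1))].
Proof.
case: k A => [|k] A hA.
  exists 0, 1; split => // s _ t1 t _.
  by rewrite /vsq big_ord0 mul0r mulr0.
pose B : 'M[C]_k.+1 := \matrix_(i, j) ((A j i)%:C)%C.
have [ls hls kls] := killed_char_poly B.
have ls0 : all (fun l => Re l < 0) ls.
  apply/allP => l /hls /eigenvalueP [v ev vn0]; apply/RltP.
  apply: (hA (Re l) (Im l) (fun i => Re (v 0 i)) (fun i => Im (v 0 i))).
  - have /rV0Pn [i vi] := vn0; exists i.
    case: (v 0 i) vi => a b /= vi.
    case: (eqVneq a 0) => [a0|/eqP]; last by left.
    case: (eqVneq b 0) => [b0|/eqP]; last by right.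
    by rewrite a0 b0 eqxx in vi.
  - move=> i; move/rowP/(_ i): ev; rewrite !mxE => /(congr1 (@complex.Re R)).
    rewrite raddf_sum => e; have -> : mv A (fun i => Re (v 0 i)) i = Re (l * v 0 i).
      rewrite -e; apply: eq_bigr => j _; rewrite mxE.
      by case: (v 0 j) => a b /=; change (A i j * a = a * A i j - b * 0); ring.
    by case: l {e} (v 0 i) => a b [c d].
  - move=> i; move/rowP/(_ i): ev; rewrite !mxE => /(congr1 (@complex.Im R)).
    rewrite raddf_sum => e; have -> : mv A (fun i => Im (v 0 i)) i = Im (l * v 0 i).
      rewrite -e; apply: eq_bigr => j _; rewrite mxE.
      by case: (v 0 j) => a b /=; change (A i j * b = a * 0 + b * A i j); ring.
    case: l {e} (v 0 i) => a b [c d] /=; change (a * d + b * c = b * c + a * d); ring.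
have [W [dW [M [lam [M0 lam0 bnd der]]]]] := lyapunov_exists B ls0.
exists M, lam; split => // s sol t1 t le1.
pose z t : 'rV[C]_k.+1 := \row_i ((s t i)%:C)%C.
have zsol : row_solution B z.
  move=> x i; have -> : (z x *m B) 0 i = ((mv A (s x) i)%:C)%C.
    rewrite mxE (rmorph_sum (real_complex R)); apply: eq_bigr => j _.
    by rewrite !mxE mulrC -rmorphM.
  split; first by apply: derivable_pt_lim_ext (sol i x) => y; rewrite mxE.
  by apply: derivable_pt_lim_ext (derivable_pt_lim_const 0 x) => y; rewrite mxE.
have nz x : sqnorm (z x) = vsq (s x).
  by apply: eq_bigr => i _; rewrite mxE /sqmod /= expr0n addr0.
have [h1 _ _] := bnd _ (kls (z t)); have [_ h2 _] := bnd _ (kls (z t1)).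
rewrite -!nz; apply: le_trans h1 _.
apply: (le_trans (gronwall (K := - lam) le1 (der z zsol) _)).
  by move=> c; have [] := bnd _ (kls (z c)).
by rewrite ler_wpM2l //; apply/RleP; left; exact: exp_pos.
Qed.

End Stability.

(** * Recurrences satisfied by products of sampled solutions *)

Section Recurrence.
Import Order.TTheory GRing.Theory Num.Theory.
Set Implicit Arguments. Unset Strict Implicit.
Local Open Scope ring_scope.
Local Arguments derivable_pt_lim (_ _ _)%_ring_scope.
Local Arguments exp _%_ring_scope.
Bind Scope ring_scope with R.

Lemma linear_ode_eq0 (E : finType) (B : E -> E -> R) (w : R -> E -> R) (t0 : R) :
  (forall t e, derivable_pt_lim (w ^~ e) t (\sum_f B e f * w t f)) ->
  (forall e, w t0 e = 0) -> forall t e, t0 <= t -> w t e = 0.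
Proof.
move=> der w0 t e le0.
pose u x := \sum_e w x e * w x e.
have du x : derivable_pt_lim u x
    (\sum_e ((\sum_f B e f * w x f) * w x e + w x e * \sum_f B e f * w x f)).
  by apply: derivable_pt_lim_sum => d; apply: derivable_pt_limM.
have le_u x d : w x d * w x d <= u x.
  by rewrite /u (bigD1 d) //= lerDl sumr_ge0 // => f _; rewrite -expr2 sqr_ge0.
pose K := \sum_e \sum_f 2 * `|B e f|.
have bound x : \sum_e ((\sum_f B e f * w x f) * w x e + w x e * \sum_f B e f * w x f)
    <= K * u x.
  rewrite mulr_suml; apply: ler_sum => d _.
  rewrite mulr_suml mulr_sumr -big_split mulr_suml; apply: ler_sum => f _ /=.
  apply: le_trans (ler_norm _) _.
  have -> : B d f * w x f * w x d + w x d * (B d f * w x f) = 2 * B d f * (w x d * w x f).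
    by ring.
  rewrite !normrM (ger0_norm (ler0n _ 2)) ler_wpM2l ?mulr_ge0 //.
  have := le_u x d; have := le_u x f; rewrite -!expr2 -(real_normK (num_real (w x d))).
  rewrite -(real_normK (num_real (w x f))).
  have := sqr_ge0 (`|w x d| - `|w x f|); lra.
have := gronwall le0 du bound.
rewrite {2}/u big1 ?mulr0 => [ut|d _]; last by rewrite w0 mulr0.
have : w t e * w t e <= 0 by apply: le_trans (le_u _ _) ut.
by rewrite -expr2 real_exprn_even_le0 ?num_real //= => /eqP.
Qed.

Definition vanishes (E : finType) (w : R -> E -> R) : Prop :=
  forall eps, 0 < eps -> exists T, forall t e, T <= t -> `|w t e| <= eps.

(* [shift_op h p w] is p(S) w, where S translates time by h. *)
Definition shift_op (E : finType) (h : R) (p : {poly R}) (w : R -> E -> R) (t : R) (e : E) : R :=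
  \sum_(j < size p) p`_j * w (t + j%:R * h) e.

Lemma shift_op_wide (E : finType) (h : R) (p : {poly R}) (w : R -> E -> R) n (t : R) e : (size p <= n)%N ->
  shift_op h p w t e = \sum_(j < n) p`_j * w (t + j%:R * h) e.
Proof.
move=> le_pn; rewrite /shift_op (big_ord_widen n (fun j => p`_j * w (t + j%:R * h) e) le_pn).
rewrite big_mkcond; apply: eq_bigr => j _; case: ltnP => // ge_j.
by rewrite nth_default ?mul0r.
Qed.

Lemma shift_op_XsubC1 (E : finType) (h : R) (p : {poly R}) (w : R -> E -> R) (t : R) e :
  shift_op h (p * ('X - 1%:P)) w t e = shift_op h p w (t + h) e - shift_op h p w t e.
Proof.
have sz : (size (p * ('X - 1%:P))%R <= (size p).+1)%N.
  by apply: leq_trans (size_polyMleq _ _) _; rewrite size_XsubC addn2.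
rewrite (shift_op_wide _ _ _ _ sz) (shift_op_wide _ _ t _ (leqnSn (size p))).
under eq_bigr => j _ do rewrite polyC1 mulrBr mulr1 coefB mulrBl.
rewrite sumrB; congr (_ - _).
rewrite big_ord_recl coefMX /= mul0r add0r; apply: eq_bigr => j _.
rewrite coefMX /= /bump leq0n add1n; congr (_ * w _ e).
by rewrite -natr1; ring.
Qed.

Lemma shift_op_divide (E : finType) (h : R) (p : {poly R}) (w : R -> E -> R) (t0 : R) : 0 < h -> vanishes w ->
  (forall t e, t0 <= t -> shift_op h (p * ('X - 1%:P)) w t e = 0) ->
  forall t e, t0 <= t -> shift_op h p w t e = 0.
Proof.
move=> h0 van rel t e le0.
have iter n : shift_op h p w (t + n%:R * h) e = shift_op h p w t e.
  elim: n => [|n IH]; first by rewrite mul0r addr0.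
  rewrite -IH; apply/eqP; rewrite -subr_eq0; apply/eqP.
  rewrite -(rel (t + n%:R * h) e) ?shift_op_XsubC1.
    by congr (shift_op h p w _ e - _); rewrite -natr1; ring.
  by rewrite (le_trans le0) // lerDl mulr_ge0 ?ler0n // ltW.
apply/eqP/contraT => n0.
pose L := \sum_(j < size p) `|p`_j|.
have L0 : 0 <= L by rewrite sumr_ge0.
pose eps := `|shift_op h p w t e| / (L + 1).
have L1 : 0 < L + 1 by rewrite ltr_wpDl.
have eps0 : 0 < eps by rewrite divr_gt0 ?normr_gt0.
have [T hT] := van eps eps0.
pose n := Num.bound `|(T - t) / h|.
have leT : T <= t + n%:R * h.
  rewrite -lerBlDl -ler_pdivrMr //.
  by rewrite (le_trans (ler_norm _)) // ltW // archi_boundP ?normr_ge0.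
have : `|shift_op h p w t e| <= L * eps.
  rewrite -(iter n) (le_trans (ler_norm_sum _ _ _)) // mulr_suml; apply: ler_sum => j _.
  rewrite normrM ler_wpM2l // hT // (le_trans leT) // lerDl mulr_ge0 ?ler0n //.
  exact: ltW.
have -> : `|shift_op h p w t e| = (L + 1) * eps by rewrite /eps mulrCA divff ?mulr1 // gt_eqF.
rewrite ler_pM2r //; lra.
Qed.

Lemma samples_recurrence (E : finType) (B : E -> E -> R) (w : R -> E -> R) (t0 h : R) :
  (forall t e, derivable_pt_lim (w ^~ e) t (\sum_f B e f * w t f)) ->
  exists p : {poly R}, [/\ p != 0, (size p <= #|E|.+1)%N
    & forall t e, t0 <= t -> shift_op h p w t e = 0].
Proof.
move=> der.
pose A : 'M[R]_(#|E|.+1, #|E|) := \matrix_(j, i) w (t0 + j%:R * h) (enum_val i).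
have kA : kermx A != 0.
  rewrite -mxrank_eq0 mxrank_ker subn_eq0 -ltnNge ltnS; exact: rank_leq_col.
have /rowV0Pn [v /sub_kermxP vA vn0] := kA.
exists (rVpoly v); split.
- by apply: contra vn0 => /eqP p0; rewrite -(rVpolyK v) p0 linear0.
- exact: size_poly.
- have wide t e : shift_op h (rVpoly v) w t e = \sum_(j < #|E|.+1) v 0 j * w (t + j%:R * h) e.
    rewrite (shift_op_wide _ _ _ _ (size_poly _ _)); apply: eq_bigr => j _.
    by rewrite coef_rVpoly_ord.
  apply: (linear_ode_eq0 (B := B)) => [t e|e].
    apply: (derivable_pt_lim_ext (fun t => \sum_(j < #|E|.+1) v 0 j * w (t + j%:R * h) e)).
      by move=> x; rewrite wide.
    apply: (@derivable_pt_lim_eq _ _ _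
      (\sum_(j < #|E|.+1) v 0 j * \sum_f B e f * w (t + j%:R * h) f)).
      under eq_bigr => f _ do rewrite wide mulr_sumr.
      rewrite exchange_big; apply: eq_bigr => j _; rewrite mulr_sumr.
      by apply: eq_bigr => f _; ring.
    apply: derivable_pt_lim_sum => j; apply: derivable_pt_limMl.
    exact: (derivable_pt_lim_shift (f := w ^~ e)).
  rewrite wide; move/rowP/(_ (enum_rank e)): vA; rewrite !mxE => vA.
  by rewrite -[RHS]vA; apply: eq_bigr => j _; rewrite mxE enum_rankK.
Qed.

(* Translation invariance together with decay rules out the eigenvalue 1, so
   every factor X - 1 of the recurrence can be removed. *)
Lemma samples_recurrence1 (E : finType) (B : E -> E -> R) (w : R -> E -> R) (t0 h : R) :
  0 < h -> vanishes w ->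
  (forall t e, derivable_pt_lim (w ^~ e) t (\sum_f B e f * w t f)) ->
  exists q : {poly R}, [/\ q.[1] != 0, (size q <= #|E|.+1)%N
    & forall t e, t0 <= t -> shift_op h q w t e = 0].
Proof.
move=> h0 van der; have [p [pn0 szp rel]] := samples_recurrence t0 h der.
have [m [q /implyP/(_ pn0) q1 pq]] := multiplicity_XsubC p 1.
exists q; split => //.
  by apply: leq_trans szp; rewrite dvdp_leq // pq dvdp_mulr.
have {}rel : forall t e, t0 <= t -> shift_op h (q * ('X - 1%:P) ^+ m) w t e = 0.
  by rewrite -pq.
elim: m rel {pq} => [|m IH] rel; first by move: rel; rewrite expr0 mulr1.
apply: IH; apply: shift_op_divide => //.
by rewrite -mulrA -exprSr.
Qed.

Lemma exp_decay (K lam t1 eps : R) : 0 <= K -> 0 < lam -> 0 < eps ->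
  exists2 T, t1 <= T & forall t, T <= t -> exp (- lam * (t - t1)) * K <= eps.
Proof.
move=> K0 lam0 eps0; exists (t1 + K / eps / lam) => [|t le_t].
  by rewrite lerDl !divr_ge0 // ltW.
have le1 : K / eps <= lam * (t - t1).
  by rewrite [lam * _]mulrC -ler_pdivrMr // lerBrDl.
have /RleP e1 := exp_ineq1_le (lam * (t - t1)).
rewrite mulNr (exp_Ropp : forall x, exp (- x) = (exp x)^-1).
have e0 : 0 < exp (lam * (t - t1)) by apply/RltP; exact: exp_pos.
rewrite mulrC ler_pdivrMr // mulrC -ler_pdivrMr //.
by apply: le_trans le1 _; apply: le_trans e1; rewrite lerDr ler01.
Qed.

Lemma mvE p q (A : mat p q) v i : mv A v i = \sum_j A i j * v j.
Proof. by []. Qed.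

Lemma products_vanish k (A : mat k k) s : hurwitz A -> solves A s ->
  vanishes (fun t (e : 'I_k * 'I_k) => s t e.1 * s t e.2).
Proof.
move=> hA sol eps eps0.
have [M [lam [M0 lam0 dec]]] := hurwitz_vsq_decay hA.
have [T T0 hT] := exp_decay 0 (mulr_ge0 M0 (vsq_ge0 (s 0))) lam0 eps0.
exists T => t [i j] le_t /=.
have := dec s sol 0 t (le_trans T0 le_t); move/le_trans/(_ (hT t le_t)); apply: le_trans.
have le_i l : `|s t l| ^+ 2 <= vsq (s t).
  rewrite real_normK ?num_real //.
  by rewrite /vsq (bigD1 l) //= lerDl sumr_ge0 // => f _; rewrite sqr_ge0.
rewrite normrM; have := le_i i; have := le_i j; have := sqr_ge0 (`|s t i| - `|s t j|); lra.
Qed.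

Lemma products_deriv k (A : mat k k) s : solves A s ->
  forall t (e : 'I_k * 'I_k), derivable_pt_lim (fun t => s t e.1 * s t e.2) t
    (\sum_f (A e.1 f.1 * (e.2 == f.2)%:R + (e.1 == f.1)%:R * A e.2 f.2)
            * (s t f.1 * s t f.2)).
Proof.
move=> sol t [i j] /=.
apply: (derivable_pt_lim_eq _ (derivable_pt_limM (sol i t) (sol j t))).
rewrite -(pair_bigA _ (fun a b => (A i a * (j == b)%:R + (i == a)%:R * A j b) * (s t a * s t b))).
under eq_bigr => a _.
  under eq_bigr => b _ do rewrite mulrDl.
  rewrite big_split /= (bigD1 j) //= [X in _ + X + _]big1 => [|b bj]; last first.
    by rewrite eq_sym (negbTE bj) mulr0 mul0r.
  over.
rewrite big_split /= [X in _ + X](bigD1 i) //= [X in _ + (_ + X)]big1 => [|a ai]; last first.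
  by rewrite big1 // => b _; rewrite eq_sym (negbTE ai) !mul0r.
rewrite !mvE mulr_suml mulr_sumr addr0; congr (_ + _); apply: eq_bigr => a _.
  by rewrite eqxx /=; ring.
by rewrite eqxx /=; ring.
Qed.

Lemma quadE k (F : mat k k) v : quad F v = \sum_i v i * \sum_j F i j * v j.
Proof. by []. Qed.

(* The point is that [rho] does not depend on [F]: the recurrence kills the
   sampled values of [quad F (s t)] for every [F], but not the constant 1. *)
Lemma quad_uniform_decrease k (A : mat k k) s (t0 t1 : R) : hurwitz A -> solves A s ->
  t0 < t1 -> exists rho, [/\ 0 < rho, rho < 1 & forall F : mat k k,
    (forall t t', t <= t' -> quad F (s t') <= quad F (s t)) ->
    quad F (s t0) <= 1 -> quad F (s t1) <= 1 - rho].
Proof.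
move=> hA sol lt01; pose E := ('I_k * 'I_k)%type.
pose h := (t1 - t0) / #|{: E}|.+1%:R.
have h0 : 0 < h by rewrite divr_gt0 ?subr_gt0 ?ltr0n.
have [q [q1 szq rel]] :=
  samples_recurrence1 t0 h0 (products_vanish hA sol) (products_deriv sol).
pose L := \sum_(j < size q) `|q`_j|; pose kap := `|q.[1]|.
have L0 : 0 <= L by rewrite sumr_ge0.
have kap0 : 0 < kap by rewrite normr_gt0.
have D0 : 0 < kap + L + 1 by rewrite ltr_wpDl // addr_ge0 // ltW.
exists (kap / (kap + L + 1)); split; first by rewrite divr_gt0.
  by rewrite ltr_pdivrMr // mul1r; lra.
move=> F anti le1.
pose f t := quad F (s t).
have sum0 : \sum_(j < size q) q`_j * f (t0 + j%:R * h) = 0.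
  transitivity (\sum_(e : E) F e.1 e.2 * shift_op h q (fun t (e : E) => s t e.1 * s t e.2) t0 e).
    under [RHS]eq_bigr => e _ do rewrite mulr_sumr.
    rewrite [RHS]exchange_big; apply: eq_bigr => j _.
    rewrite /f quadE -(pair_bigA _ (fun a b => F a b *
      (q`_j * (s (t0 + j%:R * h) a * s (t0 + j%:R * h) b)))) mulr_sumr.
    apply: eq_bigr => a _; rewrite mulrA mulr_sumr; apply: eq_bigr => b _; rewrite /=; ring.
  by rewrite big1 // => e _; rewrite rel ?lexx ?mulr0.
have fin (j : 'I_(size q)) : f t1 <= f (t0 + j%:R * h) <= 1.
  have jh : 0 <= j%:R * h by rewrite mulr_ge0 ?ler0n // ltW.
  apply/andP; split; last by apply: le_trans le1; apply: anti; rewrite lerDl.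
  apply: anti; rewrite -lerBrDl /h mulrA ler_pdivrMr ?ltr0n // mulrC.
  rewrite ler_wpM2l ?subr_ge0 ?(ltW lt01) // ler_nat.
  by rewrite (leq_trans (ltnW (ltn_ord j))).
have kapE : kap <= L * (1 - f t1).
  rewrite /kap horner_coef.
  have -> : \sum_(i < size q) q`_i * 1 ^+ i = \sum_(j < size q) q`_j * (1 - f (t0 + j%:R * h)).
    under [RHS]eq_bigr => j _ do rewrite mulrBr mulr1.
    by rewrite sumrB sum0 subr0; apply: eq_bigr => j _; rewrite expr1n mulr1.
  rewrite (le_trans (ler_norm_sum _ _ _)) // mulr_suml; apply: ler_sum => j _.
  have /andP [f1 f2] := fin j.
  by rewrite normrM ler_wpM2l // ger0_norm ?subr_ge0 // lerD2l lerN2.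
have f1 : f t1 <= 1 by apply: le_trans le1; apply: anti; exact: ltW.
rewrite -/(f t1) lerBrDl -lerBrDr ler_pdivrMr //.
have : 0 <= (1 - f t1) * kap by rewrite mulr_ge0 ?subr_ge0 // ltW.
lra.
Qed.

End Recurrence.

(** * The safety condition *)

Section Safety.
Import Order.TTheory GRing.Theory Num.Theory.
Set Implicit Arguments. Unset Strict Implicit.
Local Open Scope ring_scope.
Local Arguments derivable_pt_lim (_ _ _)%_ring_scope.
Local Arguments exp _%_ring_scope.
Local Arguments sqrt _%_ring_scope.
Bind Scope ring_scope with R.

Lemma dotE k (u v : vec k) : dot u v = \sum_i u i * v i.
Proof. by []. Qed.

Lemma dot_vsq k (v : vec k) : dot v v = vsq v.
Proof. by apply: eq_bigr => i _; rewrite expr2. Qed.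

Lemma mmE p q r (A : mat p q) (B : mat q r) i j : mm A B i j = \sum_k A i k * B k j.
Proof. by []. Qed.

Lemma maddE p q (A B : mat p q) i j : madd A B i j = A i j + B i j.
Proof. by []. Qed.

Lemma mv_mm p q r (A : mat p q) (B : mat q r) v i : mv (mm A B) v i = mv A (mv B v) i.
Proof.
rewrite !mvE; under eq_bigr => j _ do rewrite mmE mulr_suml.
rewrite exchange_big; apply: eq_bigr => j _; rewrite mvE mulr_sumr.
by apply: eq_bigr => l _; rewrite mulrA.
Qed.

Lemma dot_mv_tr p q (A : mat p q) (v : vec q) (w : vec p) :
  dot v (mv (tr A) w) = dot (mv A v) w.
Proof.
rewrite !dotE; under eq_bigr => i _ do rewrite mvE mulr_sumr.
rewrite exchange_big; apply: eq_bigr => j _; rewrite mvE mulr_suml.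
by apply: eq_bigr => i _; rewrite /tr; ring.
Qed.

Lemma eq_dot k (u v v' : vec k) : v =1 v' -> dot u v = dot u v'.
Proof. by move=> e; rewrite !dotE; apply: eq_bigr => i _; rewrite e. Qed.

Lemma quad_mm_sym k (S : mat k k) v : Defs.symmetric S -> quad (mm S S) v = vsq (mv S v).
Proof.
move=> sym; rewrite /quad (eq_dot _ (mv_mm S S v)) -dot_vsq -dot_mv_tr.
by apply: eq_dot => i; rewrite !mvE; apply: eq_bigr => j _; rewrite /tr sym.
Qed.

Lemma quad_lyapunov k (A U : mat k k) v :
  quad (madd (mm (tr A) U) (mm U A)) v = dot (mv A v) (mv U v) + dot v (mv U (mv A v)).
Proof.
rewrite -dot_mv_tr /quad !dotE -big_split; apply: eq_bigr => i _ /=.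
rewrite -!mv_mm -mulrDr; congr (_ * _); rewrite !mvE -big_split.
by apply: eq_bigr => j _; rewrite maddE mulrDl.
Qed.

Lemma quad_solves_antitone k (A U : mat k k) s : solves A s ->
  nsd (madd (mm (tr A) U) (mm U A)) ->
  forall t t', t <= t' -> quad U (s t') <= quad U (s t).
Proof.
move=> sol [_ neg] t t' le_t.
apply: (deriv_nonpos_le (f := fun x => quad U (s x))
  (f' := fun x => quad (madd (mm (tr A) U) (mm U A)) (s x)) le_t) => [x|x _].
  rewrite quad_lyapunov !dotE -big_split; apply: derivable_pt_lim_sum => i.
  apply: derivable_pt_limM; first exact: sol.
  by apply: derivable_pt_lim_sum => j; apply: derivable_pt_limMl; exact: sol.
by apply/RleP; exact: neg.
Qed.

Definition schur_block ns n (U : mat ns ns) (C : mat n ns) (delta : R) :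
  mat (ns + n) (ns + n) :=
  fun i j => match split i, split j with
             | inl i1, inl j1 => U i1 j1
             | inl i1, inr j2 => tr C i1 j2
             | inr i2, inl j1 => C i2 j1
             | inr i2, inr j2 => Rmult delta (kron i2 j2)
             end.

Lemma split_lshift n m (i : 'I_n) : split (lshift m i) = inl i.
Proof. exact: (unsplitK (inl i)). Qed.

Lemma split_rshift n m (i : 'I_m) : split (rshift n i) = inr i.
Proof. exact: (unsplitK (inr i)). Qed.

Lemma stack_lshift n m (u : vec n) (w : vec m) i : stack u w (lshift m i) = u i.
Proof. by rewrite /stack split_lshift. Qed.

Lemma stack_rshift n m (u : vec n) (w : vec m) i : stack u w (rshift n i) = w i.
Proof. by rewrite /stack split_rshift. Qed.

Lemma sum_kron k (i : 'I_k) (w : vec k) : \sum_j kron i j * w j = w i.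
Proof.
rewrite (bigD1 i) //= big1 => [|j ji]; rewrite /kron ?eqxx ?mul1r ?addr0 //.
by rewrite eq_sym (negbTE ji) mul0r.
Qed.

Lemma quad_schur_block ns n (U : mat ns ns) (C : mat n ns) delta v w :
  quad (schur_block U C delta) (stack v w) =
  quad U v + 2 * dot w (mv C v) + delta * vsq w.
Proof.
have -> : 2 * dot w (mv C v) = dot v (mv (tr C) w) + dot w (mv C v).
  by rewrite dot_mv_tr [dot (mv _ _) _]dotE [dot w _]dotE mulr2n mulrDl !mul1r;
     congr (_ + _); apply: eq_bigr => i _; rewrite mulrC.
have -> : delta * vsq w = dot w (fun i => delta * w i).
  by rewrite /vsq mulr_sumr dotE; apply: eq_bigr => i _; ring.
rewrite quadE big_split_ord /= -!addrA addrA; congr (_ + _).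
  rewrite [X in X + _]quadE dotE -big_split; apply: eq_bigr => i _ /=.
  rewrite stack_lshift big_split_ord /= -mulrDr; congr (_ * (_ + _)); apply: eq_bigr => j _.
    by rewrite stack_lshift /schur_block !split_lshift.
  by rewrite stack_rshift /schur_block split_lshift split_rshift.
rewrite !dotE -big_split; apply: eq_bigr => i _ /=.
rewrite stack_rshift big_split_ord /= -mulrDr; congr (_ * (_ + _)).
  apply: eq_bigr => j _.
  by rewrite stack_lshift /schur_block split_lshift split_rshift.
rewrite -(sum_kron i w) mulr_sumr; apply: eq_bigr => j _.
by rewrite stack_rshift /schur_block !split_rshift; change (delta * kron i j * w j = delta * (kron i j * w j)); rewrite mulrA.
Qed.

Lemma schur_bound ns n (U : mat ns ns) (C : mat n ns) delta v :
  psd (schur_block U C delta) -> 0 < vsq (mv C v) ->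
  [/\ 0 < delta, 0 <= quad U v & vsq (mv C v) <= delta * quad U v].
Proof.
move=> [_ pos] c0; set c := vsq _ in c0 *; set V := quad U v.
have key tau : 0 <= V - 2 * tau * c + tau ^+ 2 * delta * c.
  have /RleP := pos (stack v (fun i => - tau * mv C v i)).
  rewrite quad_schur_block; congr (is_true (0 <= _)).
  have -> : dot (fun i => - tau * mv C v i) (mv C v) = - tau * c.
    by rewrite dotE /c /vsq mulr_sumr; apply: eq_bigr => i _; ring.
  have -> : vsq (fun i => - tau * mv C v i) = tau ^+ 2 * c.
    by rewrite /c /vsq mulr_sumr; apply: eq_bigr => i _; ring.
  by rewrite -/V; ring.
have V0 : 0 <= V by have := key 0; rewrite mulr0 mul0r subr0 expr0n !mul0r addr0.
have d0 : 0 < delta.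
  rewrite ltNge; apply/negP => dle.
  have := key ((V + 1) / (2 * c)).
  have -> : 2 * ((V + 1) / (2 * c)) * c = V + 1 by field; rewrite gt_eqF.
  have : ((V + 1) / (2 * c)) ^+ 2 * delta * c <= 0.
    by rewrite pmulr_lle0 // mulr_ge0_le0 // sqr_ge0.
  lra.
split => //; have := key delta^-1.
have -> : V - 2 / delta * c + delta^-1 ^+ 2 * delta * c = (delta * V - c) / delta.
  by field; rewrite gt_eqF.
by rewrite pmulr_lge0 ?invr_gt0 // subr_ge0.
Qed.

Lemma vsq_eq0 k (v : vec k) : vsq v = 0 -> forall i, v i = 0.
Proof.
move=> /eqP; rewrite psumr_eq0 => [/allP h i|i _]; last exact: sqr_ge0.
by have := h i (mem_index_enum i); rewrite sqrf_eq0 => /eqP.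
Qed.

Lemma pd_mv_eq0 k (S : mat k k) v : pd S -> vsq (mv S v) = 0 -> forall i, v i = 0.
Proof.
move=> [_ pos] /vsq_eq0 Sv i; apply/eqP/contraT => vi.
have /RltP := pos v (ex_intro _ i (elimN eqP vi)).
by rewrite /quad dotE big1 ?ltxx // => j _; rewrite Sv mulr0.
Qed.

Lemma mv_Pproj n m (v : vec (n + m)) i : mv (Pproj n m) v i = v (lshift m i).
Proof.
rewrite mvE (bigD1 (lshift m i)) //= big1 => [|j ji]; rewrite /Pproj /=.
  by rewrite eqxx mul1r addr0.
by rewrite eq_sym (inj_eq val_inj (lshift m i) j) in ji *; rewrite (negbTE ji) mul0r.
Qed.

Lemma normE_rg_dev n m (s : R -> vec (n + m)) g t : normE (rg_dev s g t) = sqrt (vsq (s t)).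
Proof.
rewrite /normE dot_vsq /vsq big_split_ord /= [X in _ + X]big1 ?addr0.
  congr sqrt; rewrite big_split_ord [RHS]big_split_ord /=; congr (_ + _); apply: eq_bigr => i _.
    rewrite /rg_dev !split_lshift /xpos; congr (_ ^+ 2).
    by change (mv (Pproj n m) (s t) i + g i - g i = s t (lshift m i)); rewrite addrK mv_Pproj.
  rewrite /rg_dev split_lshift split_rshift; congr (_ ^+ 2).
  by change (s t (rshift n i) - 0 = s t (rshift n i)); rewrite subr0.
move=> i _; rewrite /rg_dev split_rshift.
by change ((g i - g i) ^+ 2 = 0); rewrite subrr expr0n.
Qed.

Lemma hurwitz_GES n m (A : mat (n + m) (n + m)) g : hurwitz A -> rg_GES A g.
Proof.
move=> hA; have [M [lam [M0 lam0 dec]]] := hurwitz_vsq_decay hA.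
exists (sqrt M), (lam / 2); split; first by apply/RltP; rewrite divr_gt0.
move=> s t1 sol t /RleP le_t; rewrite !normE_rg_dev; apply/RleP.
change (sqrt (vsq (s t)) <= sqrt M * exp (- (lam / 2) * (t - t1)) * sqrt (vsq (s t1))).
set e := exp _; have e0 : 0 <= e by apply/RleP; left; exact: exp_pos.
have ee : exp (- lam * (t - t1)) = e ^+ 2.
  by rewrite expr2 expRD RplusE; congr exp; field.
have := dec s sol t1 t le_t; rewrite ee => h; rewrite !RsqrtE.
apply: le_trans (ler_wsqrtr h) _.
by rewrite mulrA [e ^+ 2 * M]mulrC sqrtrM ?mulr_ge0 ?sqr_ge0 // sqrtrM // sqrtr_sqr ger0_norm.
Qed.

Lemma glb_exists (E : R -> Prop) (b x : R) : E x -> (forall y, E y -> b <= y) ->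
  exists d, is_glb E d.
Proof.
move=> Ex lb.
have [d [ub least]] : {d | is_lub (fun y => E (- y)) d}.
  apply: completeness; last by exists (- x); rewrite opprK.
  by exists (- b) => y /lb h; apply/RleP; rewrite lerNr.
exists (- d); split=> [y Ey|c lc].
  by apply/RleP; rewrite lerNl; apply/RleP/ub; rewrite opprK.
apply/RleP; rewrite lerNr; apply/RleP/least => y Ey; apply/RleP; rewrite lerNr.
by apply/RleP/lc.
Qed.

Lemma safe_after n m (c1 c2 : R) (O : vec n -> Prop) (A : mat (n + m) (n + m))
    (t0 t1 : R) (s : R -> vec (n + m)) (g : vec n) (Q S : mat n n) (delta0 : R) :
  hurwitz A -> solves A s -> t0 < t1 -> ~ O g -> is_sqrtm Q S ->
  is_glb (fun d => exists U, sdp_feasible A (s t0) (mm S (Pproj n m)) U d) delta0 ->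
  (forall d, is_dQ Q g O d -> Rle delta0 (pow d 2)) ->
  ~ O (xpos s g t1).
Proof.
move=> hA sol lt01 Og [pdS QS] [_ glb] safe Ox.
set v := mv (Pproj n m) (s t1).
have Cs : vsq (mv (mm S (Pproj n m)) (s t1)) = vsq (mv S v).
  by apply: eq_bigr => i _; rewrite mv_mm.
set c := vsq (mv S v) in Cs.
have [c0|cn0] := eqVneq c 0.
  apply: Og; have <- : xpos s g t1 = g => //.
  apply: functional_extensionality => i; rewrite /xpos -/v (pd_mv_eq0 pdS c0).
  by change (0 + g i = g i); rewrite add0r.
have cpos : 0 < c by rewrite lt_neqAle eq_sym cn0 vsq_ge0.
have [rho [rho0 rho1 dec]] := quad_uniform_decrease hA sol lt01.
have r0 : 0 < 1 - rho by rewrite subr_gt0.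
have lt_c : c < delta0.
  apply: (@lt_le_trans _ _ (c / (1 - rho))).
    by rewrite ltr_pdivlMr // gtr_pMr // gtrBl.
  apply/RleP/glb => d [U [lyap [/RleP le1 [blk _]]]]; apply/RleP.
  have := @schur_bound _ _ U (mm S (Pproj n m)) d (s t1) blk.
  rewrite Cs => /(_ cpos) [d0 _ le_c].
  rewrite ler_pdivrMr // (le_trans le_c) // ler_pM2l //.
  by apply: dec => //; exact: quad_solves_antitone lyap.
have normx : normQ Q (vsub g (xpos s g t1)) = sqrt c.
  rewrite /normQ -QS quad_mm_sym; last by case: pdS.
  congr sqrt; apply: eq_bigr => i _; rewrite -sqrrN; congr (_ ^+ 2).
  rewrite !mvE -sumrN; apply: eq_bigr => j _.
  by change (- (S i j * (g j - (v j + g j))) = S i j * v j); ring.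
pose E r := exists a, O a /\ r = normQ Q (vsub g a).
have lbE y : E y -> 0 <= y by move=> [a [_ ->]]; apply/RleP; exact: sqrt_pos.
have Ex : E (sqrt c) by exists (xpos s g t1).
have [d dglb] := glb_exists Ex lbE.
have d0 : 0 <= d by apply/RleP; apply: (proj2 dglb) => y /lbE /RleP.
have /RleP dle := proj1 dglb _ Ex.
have /RleP := safe d dglb; rewrite RpowE => le_d.
have : d ^+ 2 <= c.
  rewrite -(sqr_sqrtr (ltW cpos)) -RsqrtE lerXn2r // nnegrE ?sqrtr_ge0 //.
  exact: lbE Ex.
by move=> /(le_trans le_d); rewrite leNgt lt_c.
Qed.

End Safety.

Local Open Scope R_scope.

Theorem theorem1
  (n m : nat) (c1 c2 : R) (hc1 : 0 < c1) (hc12 : c1 < c2)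
  (W O : vec n -> Prop)
  (hOclosed : closed_vset O)
  (hWO : forall x, ~ W x -> O x)
  (hFopen : open_vset (fun x => W x /\ ~ O x))
  (Abar : mat (n + m) (n + m)) (hA : hurwitz Abar)
  (t0 : R) (x0 g0 : vec n) (y0 : vec m)
  (hx0 : W x0 /\ ~ O x0) (hg0 : W g0 /\ ~ O g0)
  (s : R -> vec (n + m)) (hsol : solves Abar s)
  (hinit : s t0 = stack (vsub x0 g0) y0)
  (S : mat n n) (hS : is_sqrtm (Qdir c1 c2 (vsub g0 x0)) S)
  (delta0 : R)
  (hopt : is_glb (fun d => exists U, sdp_feasible Abar (stack (vsub x0 g0) y0)
                                       (mm S (Pproj n m)) U d) delta0)
  (hsafe : forall d, is_dQ (Qdir c1 c2 (vsub g0 x0)) g0 O d -> delta0 <= d ^ 2) :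
  rg_GES Abar g0 /\
  (forall t, t0 <= t -> W (xpos s g0 t) /\ ~ O (xpos s g0 t)).
Proof.
split; first exact: hurwitz_GES.
move=> t [lt_t|<-].
  have free : ~ O (xpos s g0 t).
    rewrite -hinit in hopt; move/RltP: lt_t => lt_t.
    exact: safe_after hA hsol lt_t (proj2 hg0) hS hopt hsafe.
  by split => //; apply: NNPP => /hWO.
suff -> : xpos s g0 t0 = x0 by [].
apply: functional_extensionality => i.
by rewrite /xpos mv_Pproj hinit stack_lshift /vsub; exact: (GRing.subrK (g0 i) (x0 i)).
Qed.
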